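(* Let $p$ be an odd prime and $r\ge3$ with $p\nmid r$. Let $\mathcal{M}_1,\dots,\mathcal{M}_m,\mathcal{N}_1,\dots,\mathcal{N}_n$ be irreducible rotary augmented PX maps of length $r$ such that $\mathcal{M}_i\not\cong\mathcal{M}_j$ and $\mathcal{N}_i\not\cong\mathcal{N}_j$ for $i\ne j$. Then $\mathcal{M}_1\times\cdots\times\mathcal{M}_m\cong\mathcal{N}_1\times\cdots\times\mathcal{N}_n$ if and only if $m=n$ and there is a permutation $\sigma$ of $\{1,\dots,n\}$ with $\mathcal{M}_i\cong\mathcal{N}_{\sigma(i)}$ for all $i$.
   Context: A map is a 2-cell embedding of a connected graph (multiple edges allowed, no loops) in a closed orientable surface; it is rotary if its orientation-preserving automorphism group $G$ is arc-transitive, in which case it is isomorphic to $\mathsf{RotaMap}(G,\rho,\tau)$ for some $\rho,\tau$ with $G=\langle\rho,\tau\rangle$, $|\tau|=2$; here $\mathsf{RotaMap}(G,\rho,\tau)$ has vertices, edges, faces the left cosets of $\langle\rho\rangle,\langle\tau\rangle,\langle\rho\tau\rangle$, incidence being nonempty intersection. Direct product: for $\mathcal{M}_i=\mathsf{RotaMap}(G_i,\rho_i,\tau_i)$ and $H=\langle(\rho_1,\dots,\rho_n),(\tau_1,\dots,\tau_n)\rangle\le\prod G_i$, $\prod\mathcal{M}_i=\mathsf{RotaMap}(H,(\rho_i)_i,(\tau_i)_i)$. Augmented PX graph of length $r$: for $s\ge1$, the graph with vertex set $\mathbb{Z}_r\times\mathbb{Z}_p^s$ and edges $\{(i,x_0,\dots,x_{s-1}),(i+1,x_1,\dots,x_s)\}$;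 the cycle of length $r$ with $p$ parallel edges between adjacent vertices; or the cycle $\mathrm{C}_{pr}$. An augmented PX map of length $r$ is a map with such an underlying graph; a rotary one is irreducible if its arc-regular orientation-preserving automorphism group is isomorphic to $\mathbb{Z}_p^d\rtimes_\psi\mathrm{D}_{2r}$ with $\psi$ irreducible over $\mathbb{F}_p$. *)

(* Defs.v *)
From HB Require Import structures.
From mathcomp Require Import all_boot all_order all_fingroup all_solvable.
Set Implicit Arguments. Unset Strict Implicit. Unset Printing Implicit Defensive.

Local Open Scope group_scope.

(* An (orientable) map in the standard combinatorial encoding: a finite set of
   darts (arcs) with the rotation permutation [rot] (cyclic order of darts
   around their initial vertex) and the dart-reversing involution [edg].
   [root] is a chosen base dart, only used to form direct products.
   RotaMap(G,rho,tau) corresponds to darts G, rot g = g*rho, edg g = g*tau,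
   root = 1. *)
Record cmap := OMap { dart : finType; rot : {perm dart}; edg : {perm dart};
                      root : dart }.

(* vertices = <rot>-orbits, edges = <edg>-orbits (the cosets of <rho>, <tau>) *)
Definition mverts (M : cmap) : {set {set dart M}} :=
  [set orbit 'P <[rot M]> d | d : dart M].
Definition medges (M : cmap) : {set {set dart M}} :=
  [set orbit 'P <[edg M]> d | d : dart M].

(* well-formed map: edg a fixed-point-free involution, the monodromy group is
   transitive (connected surface), and no loops *)
Definition is_map (M : cmap) : Prop :=
  [/\ forall d, edg M (edg M d) = d,
      forall d, edg M d != d,
      [transitive <<[set rot M; edg M]>>, on [set: dart M] | 'P] &
      forall d, edg M d \notin orbit 'P <[rot M]> d].

Definition map_iso (M N : cmap) : Prop :=
  exists f : dart M -> dart N,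
    [/\ bijective f, forall d, f (rot M d) = rot N (f d) &
        forall d, f (edg M d) = edg N (f d)].

Definition mAut (M : cmap) : {group {perm dart M}} := 'C([set rot M; edg M])%G.

Definition rotary (M : cmap) : Prop :=
  [transitive mAut M, on [set: dart M] | 'P].

Definition mgraph_iso (V1 E1 : finType) (inc1 : E1 -> V1 -> bool)
    (V2 E2 : finType) (inc2 : E2 -> V2 -> bool) : Prop :=
  exists fV : V1 -> V2, exists fE : E1 -> E2,
    [/\ bijective fV, bijective fE & forall e v, inc2 (fE e) (fV v) = inc1 e v].

Definition mvtype (M : cmap) := {A : {set dart M} | A \in mverts M}.
Definition metype (M : cmap) := {A : {set dart M} | A \in medges M}.
Definition minc (M : cmap) (e : metype M) (v : mvtype M) : bool :=
  (val e :&: val v) != set0.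

Definition px_inc (r p s : nat) (e : 'I_r * {ffun 'I_s.+1 -> 'I_p})
    (v : 'I_r * {ffun 'I_s -> 'I_p}) : bool :=
  ((v.1 == e.1) && [forall k : 'I_s, v.2 k == e.2 (widen_ord (leqnSn s) k)])
  || ((v.1 == ordS e.1) && [forall k : 'I_s, v.2 k == e.2 (lift ord0 k)]).
Definition pcyc_inc (r p : nat) (e : 'I_r * 'I_p) (v : 'I_r) : bool :=
  (v == e.1) || (v == ordS e.1).
Definition cyc_inc (n : nat) (e : 'I_n) (v : 'I_n) : bool :=
  (v == e) || (v == ordS e).

Definition augPX_map (p r : nat) (M : cmap) : Prop :=
  (exists s, 0 < s /\ mgraph_iso (@minc M) (@px_inc r p s))
  \/ mgraph_iso (@minc M) (@pcyc_inc r p)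
  \/ mgraph_iso (@minc M) (@cyc_inc (p * r)).

(* irreducible: Aut^+ M = Z_p^d ><|_psi D_2r with psi irreducible over F_p,
   i.e. a normal elementary abelian p-subgroup with a complement isomorphic
   to D_2r acting irreducibly by conjugation *)
Definition irreducible_map (p r : nat) (M : cmap) : Prop :=
  exists (P K : {group {perm dart M}}),
    [/\ P ><| K = mAut M, p.-abelem P, K \isog 'D_((2 * r)%N) &
        acts_irreducibly K P 'J].

Section Prod.
Variables (m : nat) (M : 'I_m -> cmap).

Definition pdart := {dffun forall i, dart (M i)}.

Definition prot_fun (x : pdart) : pdart := [ffun i => rot (M i) (x i)].
Definition pedg_fun (x : pdart) : pdart := [ffun i => edg (M i) (x i)].
Definition proot : pdart := [ffun i => root (M i)].

Lemma prot_inj : injective prot_fun.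
Proof.
move=> x y /ffunP H; apply/ffunP=> i; move: (H i); rewrite !ffunE.
exact: perm_inj.
Qed.
Lemma pedg_inj : injective pedg_fun.
Proof.
move=> x y /ffunP H; apply/ffunP=> i; move: (H i); rewrite !ffunE.
exact: perm_inj.
Qed.

Definition pstep (x y : pdart) : bool := (y == prot_fun x) || (y == pedg_fun x).
(* darts of the product: the orbit of the root under <(rho_i), (tau_i)> *)
Definition pcomp : {set pdart} := [set x | connect pstep proot x].

Lemma pcomp_rot x : x \in pcomp -> prot_fun x \in pcomp.
Proof.
rewrite !inE => H; apply: connect_trans H _; apply: connect1.
by rewrite /pstep eqxx.
Qed.
Lemma pcomp_edg x : x \in pcomp -> pedg_fun x \in pcomp.
Proof.
rewrite !inE => H; apply: connect_trans H _; apply: connect1.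
by rewrite /pstep eqxx orbT.
Qed.

Definition pdart_sub := {x : pdart | x \in pcomp}.

Definition prot_sub (x : pdart_sub) : pdart_sub :=
  exist _ (prot_fun (val x)) (pcomp_rot (valP x)).
Definition pedg_sub (x : pdart_sub) : pdart_sub :=
  exist _ (pedg_fun (val x)) (pcomp_edg (valP x)).

Lemma prot_sub_inj : injective prot_sub.
Proof. by move=> x y [] /prot_inj H; apply: val_inj. Qed.
Lemma pedg_sub_inj : injective pedg_sub.
Proof. by move=> x y [] /pedg_inj H; apply: val_inj. Qed.

Lemma proot_in : proot \in pcomp.
Proof. by rewrite inE connect0. Qed.

Definition prod_map : cmap :=
  @OMap pdart_sub (perm prot_sub_inj) (perm pedg_sub_inj)
        (exist _ proot proot_in).
End Prod.

(* Main.v *)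
From mathcomp Require Import all_boot all_order all_fingroup all_solvable.
Require Import Defs.
Set Implicit Arguments. Unset Strict Implicit. Unset Printing Implicit Defensive.

(** Let [E] be the product of the [M i], and let [Q], generated by [x = rot E]
    and [y = edg E], be its monodromy group. Every rotary quotient of [E]
    corresponds to a normal subgroup of [Q], and isomorphic quotients to equal
    subgroups. An irreducible factor has valency [2] or [2p], so [x] maps to an
    involution of the quotient [D_2r] of its group; hence the preimage in [Q] of
    the elementary abelian part is the same subgroup [W] for all factors, namely
    the normal closure of [x^2] and [(xy)^r]. The factors thus become maximal
    [Q]-submodules of [W], and those of the [M i] intersect trivially.

    It remains to see that [W] is multiplicity free: a maximal submodule that
    contains an intersection of maximal submodules is one of them. Let [W / K]
    and [W / L] be isomorphic simple modules and [c = xy]. If [c] has no fixed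
    points on them, they are generated by the images of [x^2], which is fixed by
    [x]; the [x]-fixed part of a simple module is spanned by the images of any of
    its nonzero vectors under the operators [c^k + c^-k], and these are
    central, so that an equivariant map matches the two generators and [K = L].
    Otherwise [c] acts trivially, [x] acts as [1] or [-1], and the modules are
    cyclic, generated by [x^2] (with [((xy)^r)^2 = (x^2)^r]) or by [(xy)^r]. *)

(** * Maximal normal subgroups *)

Section NormalGraph.
Local Open Scope group_scope.
Variable gT : finGroupType.
Implicit Types (Q W R K L H : {group gT}) (S : {set gT}).

(** As 2 is prime to its order, [w] is a power of [w ^+ 2]. *)
Lemma odd_sqr_mem H (w : gT) : odd #[w] -> w ^+ 2 \in H -> w \in H.
Proof.
move=> odd_w w2H; have: generator <[w]> (w ^+ 2).
  by rewrite generator_coprime coprimen2.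
rewrite /generator => /eqP gen_w; apply: (subsetP (_ : <[w ^+ 2]> \subset H)).
  by rewrite cycle_subG.
by rewrite -gen_w cycle_id.
Qed.

(** With [c = x * y], conjugation by [y] takes [c] to [y * x = c^-1 * x ^+ 2]. It fixes
    [b = c ^+ r], so [b = b^-1 * (x ^+ 2) ^+ r]. *)
Lemma expg_prod_involution (x y : gT) r : y ^+ 2 = 1 ->
    commute (x ^+ 2) y -> commute ((x * y) ^+ r) y ->
  ((x * y) ^+ r) ^+ 2 = (x ^+ 2) ^+ r.
Proof.
move=> y2 cay cby; set b := (x * y) ^+ r.
have yV : y^-1 = y by apply/eqP; rewrite eq_invg_mul -expg2 y2.
have cac : commute (x * y)^-1 (x ^+ 2).
  by apply/commute_sym/commuteV/commuteM => //; apply/commute_sym/commuteX.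
have Dyx : y * x = (x * y)^-1 * x ^+ 2.
  by rewrite invMg yV -mulgA expg2 mulKg.
have: b = b^-1 * (x ^+ 2) ^+ r.
  rewrite -{1}[b](_ : b ^ y = b); last by apply/conjg_fixP/commgP.
  rewrite /b conjXg (_ : (x * y) ^ y = y * x); last first.
    by rewrite conjgE yV -(mulgA x) -expg2 y2 mulg1.
  by rewrite Dyx expgMn // expgVn.
by move=> Db; rewrite expg2 {2}Db mulKVg.
Qed.

Lemma maxnormal_between Q W K H :
    maxnormal K W Q -> K \subset H -> H \subset W -> Q \subset 'N(H) ->
  ~~ (H \subset K) -> H :=: W.
Proof.
case/maxgroupP=> _ maxK sKH sHW nHQ; apply: contraNeq => neqHW.
by rewrite (maxK H) // properEneq neqHW sHW nHQ.
Qed.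

Lemma maxnormal_mulG Q W K H :
    maxnormal K W Q -> W \subset Q -> H \subset W -> Q \subset 'N(H) ->
  ~~ (H \subset K) -> H * K = W.
Proof.
move=> maxK sWQ sHW nHQ not_sHK.
have /andP[/proper_sub sKW nKQ] := maxgroupp maxK.
have nKH : H \subset 'N(K) by rewrite (subset_trans sHW) ?(subset_trans sWQ).
rewrite -norm_joinEl //; apply: (maxnormal_between maxK).
- exact: joing_subr.
- by rewrite join_subG sHW.
- by rewrite normsY.
by apply: contra not_sHK; apply: subset_trans; apply: joing_subl.
Qed.

Lemma maxnormal_eq Q W K L :
  maxnormal K W Q -> maxnormal L W Q -> K \subset L -> K = L.
Proof.
by case/maxgroupP=> _ maxK /maxgroupp nL sKL; apply: val_inj; rewrite /= (maxK L).
Qed.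

Lemma eq_coset H u v : u \in 'N(H) -> v \in 'N(H) ->
  (coset H u == coset H v) = (u^-1 * v \in H).
Proof.
move=> Nu Nv; have Nuv : u^-1 * v \in 'N(H) by rewrite groupM ?groupV.
rewrite eq_mulVg1 -morphV // -morphM ?groupV //=.
by apply/eqP/idP => [/(coset_idr Nuv)|/coset_id].
Qed.

(* The set [T] below is the pullback to [W] of the graph of the homomorphism
   [W / K -> W / L] induced by [phi] through [W / K = R / (R :&: K)]. *)
Lemma sub_of_equivariant Q W R K L S (phi : gT -> gT) :
    abelian W -> odd #|W| -> W <| Q -> K \subset W -> L \subset W ->
    Q \subset 'N(K) -> Q \subset 'N(L) -> R \subset W -> Q \subset 'N(R) ->
    R :&: K \subset L -> S \subset W -> W \subset <<class_support S Q>> ->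
    {in W, forall w, phi w \in W} ->
    {in W &, {morph phi : u v / u * v}} ->
    {in W & Q, forall w g, phi (w ^ g) = phi w ^ g} ->
    {in L, forall w, phi w \in L} ->
    {in S, forall a, exists2 u, u \in R &
       coset K u = coset K a /\ coset L (phi u) = coset L (a ^+ 2)} ->
  K \subset L.
Proof.
move=> abW oddW /andP[sWQ nWQ] sKW sLW nKQ nLQ sRW nRQ sRKL sSW sWS.
move=> phiW phiM phiJ phiL genS.
have nKW := subset_trans sWQ nKQ; have nLW := subset_trans sWQ nLQ.
have cW : {in W &, commutative mulg} by move=> u v Wu Wv; apply: (centsP abW).
(* The square allows for operators [phi] that match generators only up to a factor 2, such as sums
   of [c^k + c^-k]. *)
pose T := [set w in W | [exists u in R,
  (coset K u == coset K w) && (coset L (phi u) == coset L (w ^+ 2))]].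
have TP w : reflect (w \in W /\ exists2 u, u \in R &
    coset K u = coset K w /\ coset L (phi u) = coset L (w ^+ 2)) (w \in T).
  rewrite inE; apply: (iffP andP) => [[Ww /existsP[u /and3P[Ru /eqP? /eqP?]]]|].
    by split=> //; exists u.
  case=> Ww [u Ru [Ku Lu]]; split=> //.
  by apply/existsP; exists u; rewrite Ru Ku Lu !eqxx.
have phi1 : phi 1 = 1.
  by apply: (mulgI (phi 1)); rewrite -phiM ?group1 // !mulg1.
have group_T : group_set T.
  apply/group_setP; split.
    by apply/TP; split=> //; exists 1; rewrite ?phi1 ?expg1n.
  move=> w w' /TP[Ww [u Ru [Ku Lu]]] /TP[Ww' [u' Ru' [Ku' Lu']]].
  apply/TP; split; first exact: groupM.
  have [Wu Wu'] := (subsetP sRW u Ru, subsetP sRW u' Ru').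
  exists (u * u'); first exact: groupM.
  have NK z : z \in W -> z \in 'N(K) by move/(subsetP nKW).
  have NL z : z \in W -> z \in 'N(L) by move/(subsetP nLW).
  have cww' : commute w w' := cW w w' Ww Ww'.
  rewrite phiM // expgMn //.
  by rewrite !morphM ?NK ?NL ?groupX ?phiW //= Ku Ku' Lu Lu' !morphM ?NL.
have nTQ g w : g \in Q -> w \in T -> w ^ g \in T.
  move=> Qg /TP[Ww [u Ru [Ku Lu]]]; apply/TP; split.
    by rewrite memJ_norm // (subsetP nWQ).
  have Wu := subsetP sRW u Ru.
  have NK z : z \in W -> z \in 'N(K) by move/(subsetP nKW).
  have NL z : z \in W -> z \in 'N(L) by move/(subsetP nLW).
  exists (u ^ g); first by rewrite memJ_norm // (subsetP nRQ).
  rewrite phiJ // -conjXg !morphJ ?(subsetP nKQ g Qg) ?(subsetP nLQ g Qg)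
    ?NK ?NL ?phiW ?groupX //=.
  by rewrite Ku Lu.
have sWT : W \subset Group group_T.
  apply: subset_trans sWS _; rewrite gen_subG; apply/subsetP=> _ /imset2P[a g Sa Qg ->].
  apply: nTQ => //; apply/TP; split; first exact: (subsetP sSW).
  exact: genS.
(* The [u] matched with an element [w] of [K] lies in [R :&: K], hence in [L]. So [w ^+ 2] is in
   [L], and [w] too, having odd order. *)
apply/subsetP=> w Kw; have Ww := subsetP sKW w Kw.
have /TP[_ [u Ru [Ku Lu]]] := subsetP sWT w Ww.
have Wu := subsetP sRW u Ru.
have Lu1 : u \in L.
  apply: (subsetP sRKL); rewrite inE Ru /= coset_idr ?(subsetP nKW) //.
  by rewrite Ku coset_id.
apply: odd_sqr_mem; first exact: dvdn_odd (order_dvdG Ww) _.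
by apply: coset_idr; rewrite ?groupX ?(subsetP nLW) // -Lu coset_id ?phiL.
Qed.

End NormalGraph.

(** * Submodules over a dihedral group *)

Section DihedralModule.
Local Open Scope group_scope.
Variables (gT : finGroupType) (Q W : {group gT}) (x y : gT) (r : nat).
Let c := x * y.
Hypotheses (defQ : Q :=: <<[set x; y]>>) (y2 : y ^+ 2 = 1) (nsWQ : W <| Q).
Hypotheses (abW : abelian W) (oddW : odd #|W|).
Hypothesis defW : W :=: <<class_support [set x ^+ 2; c ^+ r] Q>>.
Implicit Types K L R H : {group gT}.

Let Qx : x \in Q. Proof. by rewrite defQ mem_gen ?set21. Qed.
Let Qy : y \in Q. Proof. by rewrite defQ mem_gen ?set22. Qed.
Let Qc : c \in Q. Proof. exact: groupM. Qed.
Let sWQ : W \subset Q. Proof. exact: normal_sub. Qed.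
Let nWQ : Q \subset 'N(W). Proof. exact: normal_norm. Qed.
Let WJ w g : w \in W -> g \in Q -> w ^ g \in W.
Proof. by move=> Ww Qg; rewrite memJ_norm // (subsetP nWQ). Qed.
Let cW : {in W &, forall u v, commute u v}.
Proof. by move=> u v Wu Wv; apply: (centsP abW). Qed.
Let WC u v : u \in W -> v \in W -> u * v = v * u.
Proof. exact: cW. Qed.
Let WCA t u v w : u \in W -> v \in W -> t * u * (v * w) = t * v * (u * w).
Proof. by move=> Wu Wv; rewrite -!mulgA (mulgA u) (WC Wu Wv) -!mulgA. Qed.
Let genW : [set x ^+ 2; c ^+ r] \subset W.
Proof. by rewrite defW sub_gen ?sub_class_support. Qed.
Let Wa : x ^+ 2 \in W. Proof. by rewrite (subsetP genW) ?set21. Qed.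
Let Wb : c ^+ r \in W. Proof. by rewrite (subsetP genW) ?set22. Qed.
Let yE : y = x^-1 * c. Proof. by rewrite mulKg. Qed.

Lemma gen_sub_eq K : Q \subset 'N(K) -> K \subset W ->
  x ^+ 2 \in K -> c ^+ r \in K -> W \subset K.
Proof.
move=> nKQ sKW Ka Kb; rewrite defW gen_subG; apply/subsetP=> _ /imset2P[a g + Qg ->].
by rewrite memJ_norm ?(subsetP nKQ) // => /set2P[]->.
Qed.

Lemma conj_sqr w : w \in W -> w ^ (x ^+ 2) = w.
Proof. by move=> Ww; apply: conjg_fixP; apply/commgP/cW. Qed.

(** On [W], [x] inverts [c]: [c * x = x * c^-1 * x ^+ 2], and [x ^+ 2], an element of the abelian
    group [W], acts trivially. *)
Lemma conj_rot w : w \in W -> (w ^ c) ^ x = (w ^ x) ^ c^-1.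
Proof.
move=> Ww; rewrite -!conjgM; have -> : c * x = x * c^-1 * x ^+ 2.
  have yV : y^-1 = y by apply/eqP; rewrite eq_invg_mul -expg2 y2.
  by rewrite /c invMg yV expgS expg1 !mulgA mulgKV.
by rewrite [LHS]conjgM conj_sqr // WJ // groupM ?groupV.
Qed.

Lemma conj_rotX w k : w \in W -> (w ^ (c ^+ k)) ^ x = (w ^ x) ^ (c ^- k).
Proof.
elim: k w => [|k IHk] w Ww; first by rewrite expg0 invg1 !conjg1.
by rewrite expgS conjgM IHk ?WJ // conj_rot // -conjgM -invMg -expgSr expgS.
Qed.

Lemma conj_rotVX w k : w \in W -> (w ^ (c ^- k)) ^ x = (w ^ x) ^ (c ^+ k).
Proof.
move=> Ww; have Wwx : w ^ c ^- k \in W by rewrite WJ ?groupV ?groupX.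
have := conj_rotX k Wwx; rewrite conjgKV => ->.
by rewrite conjgKV.
Qed.

Lemma norm_rot_sub H : x \in 'N(H) -> c \in 'N(H) -> Q \subset 'N(H).
Proof.
move=> Nx Nc; rewrite defQ gen_subG; apply/subsetP=> z /set2P[]-> //.
by rewrite yE groupM ?groupV.
Qed.

Definition trivial_mod L g := {in W, forall w, coset L (w ^ g) = coset L w}.
Definition free_mod L g :=
  {in W, forall w, coset L (w ^ g) = coset L w -> w \in L}.

(** * Action of the generators on a simple quotient *)

Section OneSubmodule.
Variable L : {group gT}.
Hypothesis maxL : maxnormal L W Q.

Let sLW : L \subset W. Proof. by case/andP: (maxgroupp maxL) => /proper_sub. Qed.
Let nLQ : Q \subset 'N(L). Proof. by case/andP: (maxgroupp maxL). Qed.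
Let NL g : g \in Q -> g \in 'N(L). Proof. exact: subsetP. Qed.
Let NLW w : w \in W -> w \in 'N(L).
Proof. by move/(subsetP sWQ)/NL. Qed.
Let cosetJ w g : w \in W -> g \in Q -> coset L (w ^ g) = coset L w ^ coset L g.
Proof. by move=> Ww Qg; rewrite morphJ ?(NLW Ww) ?(NL Qg). Qed.

(** The fixed points of [g] in [W / L] pull back to a subgroup [F] of [W] containing [L]. Stability
    under [x] and [c] makes it a submodule, so by maximality it is [L] or [W]. *)
Lemma trivial_or_free g : g \in Q ->
    (forall w h, w \in W -> h \in [set x; c] -> coset L (w ^ g) = coset L w ->
       coset L ((w ^ h) ^ g) = coset L (w ^ h)) ->
  trivial_mod L g \/ free_mod L g.
Proof.
move=> Qg stab; pose F := (W :&: coset L @*^-1 'C[coset L g])%G.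
have FP w : w \in W -> (w \in F) = (coset L (w ^ g) == coset L w).
  move=> Ww; rewrite /= inE Ww /= morphpreE inE (NLW Ww) /= inE; apply/cent1P/eqP.
    by move=> cgw; rewrite cosetJ // conjgE cgw mulKg.
  rewrite cosetJ // conjgE => e.
  by rewrite /commute -{2}e mulKVg.
have nF h : h \in [set x; c] -> h \in 'N(F).
  move=> hxc; apply/normP/eqP; rewrite eqEcard cardJg leqnn andbT.
  have Qh : h \in Q by case/set2P: hxc => ->.
  apply/subsetP=> _ /imsetP[w Fw ->]; have Ww : w \in W by case/setIP: Fw.
  by rewrite FP ?WJ //; apply/eqP; apply: stab => //; apply/eqP; rewrite -FP.
have nFQ : Q \subset 'N(F) by apply: norm_rot_sub; apply: nF; rewrite ?set21 ?set22.
have sLF : L \subset F.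
  apply/subsetP=> w Lw; rewrite FP ?(subsetP sLW) //.
  by rewrite !coset_id // memJ_norm ?NL.
have [sFL | not_sFL] := boolP (F \subset L).
  by right=> w Ww e; apply: (subsetP sFL); rewrite FP // e.
left=> w Ww; apply/eqP; rewrite -FP //.
by rewrite (maxnormal_between maxL sLF) ?subsetIl.
Qed.

(** Since [x] inverts [c], it preserves the fixed points of [c]. *)
Lemma rot_trivial_or_free : trivial_mod L c \/ free_mod L c.
Proof.
apply: trivial_or_free => // w h Ww /set2P[]-> e.
  have -> : (w ^ x) ^ c = (w ^ c^-1) ^ x by rewrite (conj_rotVX 1).
  rewrite !cosetJ ?WJ ?groupV // in e *.
  by rewrite -{1}e morphV ?NL //= conjgK.
by rewrite !cosetJ ?WJ // in e *; rewrite !e.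
Qed.

Lemma refl_trivial_or_free : trivial_mod L c -> trivial_mod L x \/ free_mod L x.
Proof.
move=> tc; apply: trivial_or_free => // w h Ww /set2P[]-> e.
  by rewrite !cosetJ ?WJ // in e *; rewrite !e.
rewrite [RHS]tc // -e cosetJ ?WJ // tc //.
by rewrite cosetJ.
Qed.

End OneSubmodule.

(** Each coset of [K] in [W] contains some [u] in [R], and [u^-1 * u ^ g] lies in [R :&: L], hence
    in [K]. *)
Lemma trivial_mod_transfer K L R g :
    maxnormal K W Q -> maxnormal L W Q -> R \subset W -> Q \subset 'N(R) ->
    R * K = W -> R :&: L \subset K -> g \in Q ->
  trivial_mod L g -> trivial_mod K g.
Proof.
move=> maxK maxL sRW nRQ defRK sRLK Qg tL w; rewrite -defRK => /mulsgP[u k Ru Kk ->].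
have /andP[/proper_sub sKW nKQ] := maxgroupp maxK.
have /andP[_ nLQ] := maxgroupp maxL.
have NQ H z : Q \subset 'N(H) -> z \in W -> z \in 'N(H).
  by move=> nHQ Wz; apply/(subsetP nHQ)/(subsetP sWQ).
have [Wu Wk] := (subsetP sRW u Ru, subsetP sKW k Kk).
have Wug := WJ Wu Qg.
have Kkg : k ^ g \in K by rewrite memJ_norm ?(subsetP nKQ).
have [NKu NKug] : u \in 'N(K) /\ u ^ g \in 'N(K) by rewrite !(NQ K).
have NKK z : z \in K -> z \in 'N(K) by apply: subsetP (normG K) z.
rewrite conjMg (morphM _ NKug (NKK _ Kkg)) (morphM _ NKu (NKK _ Kk)) /=.
rewrite (coset_id Kk) (coset_id Kkg).
rewrite !mulg1; apply/eqP; rewrite eq_sym eq_coset ?(NQ K) //.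
apply: (subsetP sRLK); rewrite inE groupM ?groupV //=.
  by rewrite -eq_coset ?(NQ L) // tL.
by rewrite memJ_norm // (subsetP nRQ).
Qed.

(** * Operators from the group ring *)

Section ConjugateProducts.
Variable s : seq nat.

(** In additive terms, the sum of the [f k] in the integral group ring, applied to [w]. *)
Definition conj_prod (f : nat -> gT) (w : gT) := \prod_(k <- s) w ^ f k.

Lemma conj_prod_in H f w : (forall k, f k \in Q) -> Q \subset 'N(H) -> w \in H ->
  conj_prod f w \in H.
Proof.
move=> Qf nHQ Hw; rewrite /conj_prod.
by apply: group_prod => k _; rewrite memJ_norm // (subsetP nHQ).
Qed.

Lemma conj_prodM f : (forall k, f k \in Q) ->
  {in W &, {morph conj_prod f : u v / u * v}}.
Proof.
move=> Qf u v Wu Wv; rewrite /conj_prod.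
elim: s => [|k s' IH]; first by rewrite !big_nil mulg1.
have Wp : \prod_(j <- s') u ^ f j \in W by apply: group_prod => j _; apply: WJ.
rewrite !big_cons IH conjMg; apply: WCA => //; exact: WJ.
Qed.

(** The group ring element here is the sum of [c^k + c^-k] over [k] in [s]. *)
Definition sym_prod w :=
  conj_prod (fun k => c ^+ k) w * conj_prod (fun k => c ^- k) w.

Let Qck k : c ^+ k \in Q. Proof. exact: groupX. Qed.
Let QcVk k : c ^- k \in Q. Proof. by rewrite groupV groupX. Qed.

Lemma sym_prod_in H w : Q \subset 'N(H) -> w \in H -> sym_prod w \in H.
Proof. by move=> nHQ Hw; rewrite groupM ?conj_prod_in. Qed.

Lemma sym_prodM : {in W &, {morph sym_prod : u v / u * v}}.
Proof.
move=> u v Wu Wv; rewrite /sym_prod !conj_prodM //.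
by apply: WCA; rewrite conj_prod_in.
Qed.

Lemma conj_prod_rot f w :
  (forall k, commute (f k) c) -> conj_prod f (w ^ c) = conj_prod f w ^ c.
Proof.
move=> cf; rewrite /conj_prod.
elim: s => [|k s' IH]; first by rewrite !big_nil conj1g.
by rewrite !big_cons IH [RHS]conjMg -!conjgM cf.
Qed.

Lemma conj_prod_refl f g w : w \in W ->
    {in W, forall w k, (w ^ f k) ^ x = (w ^ x) ^ g k} ->
  conj_prod f w ^ x = conj_prod g (w ^ x).
Proof.
move=> Ww fg; rewrite /conj_prod.
elim: s => [|k s' IH]; first by rewrite !big_nil conj1g.
by rewrite !big_cons [LHS]conjMg IH fg.
Qed.

(* The elements [c^k + c^-k] of the group ring are central. *)
Lemma sym_prodJ : {in W & Q, forall w g, sym_prod (w ^ g) = sym_prod w ^ g}.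
Proof.
pose D := [set g in Q | [forall w in W, sym_prod (w ^ g) == sym_prod w ^ g]].
have DP g : reflect (g \in Q /\ {in W, forall w, sym_prod (w ^ g) = sym_prod w ^ g})
    (g \in D).
  rewrite inE; apply: (iffP andP) => [[Qg /forall_inP Dg]|[Qg Dg]]; split=> //.
    by move=> w /Dg/eqP.
  by apply/forall_inP=> w /Dg/eqP.
have gD : group_set D.
  apply/group_setP; split=> [|g h /DP[Qg Dg] /DP[Qh Dh]]; apply/DP; split=> //.
  - by move=> w _; rewrite !conjg1.
  - exact: groupM.
  by move=> w Ww; rewrite !conjgM Dh ?WJ // Dg.
have Dc : c \in Group gD.
  apply/DP; split=> // w Ww; rewrite /sym_prod conjMg !conj_prod_rot // => k.
    exact/commute_sym/commuteV/commuteX.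
  exact/commute_sym/commuteX.
(* Conjugation by [x] exchanges the two factors of [sym_prod], which commute in [W]. *)
have Dx : x \in Group gD.
  apply/DP; split=> // w Ww; rewrite /sym_prod conjMg.
  rewrite (@conj_prod_refl _ (fun k => c ^- k)) //; last by move=> *; apply: conj_rotX.
  rewrite (@conj_prod_refl _ (fun k => c ^+ k)) //; last by move=> *; apply: conj_rotVX.
  by apply: WC; rewrite conj_prod_in ?WJ.
suff /subsetP sQD : Q \subset Group gD by move=> w g Ww /sQD/DP[_ ->].
rewrite defQ gen_subG; apply/subsetP=> z /set2P[]-> //.
by rewrite yE groupM ?groupV.
Qed.

End ConjugateProducts.

Lemma conj_prod_coset L s f u v :
    (forall k, f k \in Q) -> L \subset W -> Q \subset 'N(L) -> u \in W -> v \in W ->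
  coset L u = coset L v -> coset L (conj_prod s f u) = coset L (conj_prod s f v).
Proof.
move=> Qf sLW nLQ Wu Wv /eqP; have nLW := subsetP (subset_trans sWQ nLQ).
rewrite eq_coset ?nLW // => Luv; apply/eqP; rewrite eq_coset ?nLW ?conj_prod_in //.
have -> : v = u * (u^-1 * v) by rewrite mulKVg.
by rewrite (conj_prodM s Qf Wu (subsetP sLW _ Luv)) mulKg conj_prod_in.
Qed.

(** In a finite group inverses are positive powers, so nonnegative coefficients, given by
    repetitions in [s], suffice. *)
Lemma orbit_conj_prod u v :
  v \in <<u ^: <[c]> >> -> exists s, v = conj_prod s (fun k => c ^+ k) u.
Proof.
case/gen_prodgP=> n [e Be ->].
have [i|k ek] := @fin_all_exists _ _ (fun i k => e i = u ^ c ^+ k).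
  by have /imsetP[_ /cycleP[k ->] ->] := Be i; exists k.
exists [seq k i | i <- index_enum 'I_n]; rewrite /conj_prod big_map.
exact: eq_bigr.
Qed.

(** Modulo [L], applying [x] to the expression of [a] as a sum of [c^k u] fixes [a] and [u] and
    turns [c^k] into [c^-k]. Adding both expressions gives twice [a]. *)
Lemma sym_prod_sqr L s a u : L \subset W -> Q \subset 'N(L) ->
    a \in W -> u \in W -> a ^ x = a -> coset L (u ^ x) = coset L u ->
    coset L a = coset L (conj_prod s (fun k => c ^+ k) u) ->
  coset L (sym_prod s u) = coset L (a ^+ 2).
Proof.
move=> sLW nLQ Wa' Wu ax Lux La; have nLW := subsetP (subset_trans sWQ nLQ).
have Qck k : c ^+ k \in Q by rewrite groupX.
have QcVk k : c ^- k \in Q by rewrite groupV.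
set v := conj_prod s _ u in La; have Wv : v \in W by rewrite conj_prod_in.
have Lax : coset L a = coset L (conj_prod s (fun k => c ^- k) u).
  rewrite -{1}ax morphJ ?(subsetP nLQ x Qx) ?nLW //= La.
  rewrite -morphJ ?(subsetP nLQ x Qx) ?nLW //=.
  rewrite (@conj_prod_refl _ _ (fun k => c ^- k)) //; last by move=> *; apply: conj_rotX.
  by apply: conj_prod_coset => //; apply: WJ.
rewrite /sym_prod -/v morphM ?nLW ?conj_prod_in //= -La -Lax.
by rewrite -morphM ?nLW.
Qed.

(** * Maximal submodules with isomorphic quotients *)

Section TwoSubmodules.
Variables K L R : {group gT}.
Hypotheses (maxK : maxnormal K W Q) (maxL : maxnormal L W Q).
Hypotheses (sRW : R \subset W) (nRQ : Q \subset 'N(R)).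
Hypotheses (sRKL : R :&: K \subset L) (not_sRL : ~~ (R \subset L)).

Let sKW : K \subset W. Proof. by case/andP: (maxgroupp maxK) => /proper_sub. Qed.
Let nKQ : Q \subset 'N(K). Proof. by case/andP: (maxgroupp maxK). Qed.
Let sLW : L \subset W. Proof. by case/andP: (maxgroupp maxL) => /proper_sub. Qed.
Let nLQ : Q \subset 'N(L). Proof. by case/andP: (maxgroupp maxL). Qed.
Let nKW w : w \in W -> w \in 'N(K).
Proof. by move/(subsetP sWQ)/(subsetP nKQ). Qed.
Let nLW w : w \in W -> w \in 'N(L).
Proof. by move/(subsetP sWQ)/(subsetP nLQ). Qed.

Let not_sRK : ~~ (R \subset K).
Proof. by apply: contra not_sRL => sRK; rewrite -(setIidPl sRK). Qed.

Let defRK : R * K = W. Proof. exact: maxnormal_mulG maxK _ _ _ _. Qed.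
Let defRL : R * L = W. Proof. exact: maxnormal_mulG maxL _ _ _ _. Qed.

(** This makes the hypotheses symmetric in [K] and [L]. Otherwise [(R :&: L) * K = W]; splitting an
    element of [R] accordingly puts its second factor in [R :&: K], hence in [L], and [R] would lie
    in [L]. *)
Let sRLK : R :&: L \subset K.
Proof.
apply: contraR not_sRL => not_sRLK.
have defRLK : (R :&: L) * K = W.
  by rewrite (maxnormal_mulG maxK) ?normsI // subIset ?sRW.
apply/subsetP=> u Ru; have: u \in W by apply: (subsetP sRW).
rewrite -defRLK => /mulsgP[v k /setIP[Rv Lv] Kk Du].
rewrite Du groupM // (subsetP sRKL) // inE Kk andbT.
by rewrite -(groupMl _ Rv) -Du.
Qed.

Let not_sWK : ~~ (W \subset K).
Proof. by case/andP: (maxgroupp maxK) => /andP[]. Qed.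

Let lift_mod w : w \in W -> exists2 u, u \in R & coset K u = coset K w.
Proof.
rewrite -{1}defRK => /mulsgP[u k Ru Kk ->]; exists u => //.
have Wu : u \in W by apply: (subsetP sRW).
apply/eqP; rewrite eq_coset ?mulKg //; first exact: nKW.
by rewrite groupM ?nKW // (subsetP sKW).
Qed.

Let lift_memL u w : u \in R -> w \in W -> coset K u = coset K w -> u \in L -> w \in K.
Proof.
move=> Ru Ww Kuw Lu; have Ku : u \in K by rewrite (subsetP sRLK) // inE Ru.
by rewrite coset_idr ?nKW // -Kuw coset_id.
Qed.

(** Every subgroup between [L] and [W] is a submodule here, so the simple module [W / L] is cyclic.
    A power map then serves as the equivariant operator, and matching [w] suffices because both
    generators are the same powers of [w] modulo [K] and modulo [L]. *)
Lemma submodule_eq_cyclic w :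
    {in W, forall v, coset L (v ^ x) = coset L v \/ coset L (v ^ x) = coset L v^-1} ->
    trivial_mod L c -> w \in W ->
    {in [set x ^+ 2; c ^+ r], forall a, exists i,
       coset K a = coset K (w ^+ i) /\ coset L a = coset L (w ^+ i)} ->
  K = L.
Proof.
move=> Lx Lc Ww genw; have [u Ru Ku] := lift_mod Ww.
have Wu := subsetP sRW u Ru.
(* Otherwise [w], and with it both generators of [W], would lie in [K]. *)
have not_Lu : u \notin L.
  apply: contra not_sWK => Lu; have Kw := lift_memL Ru Ww Ku Lu.
  have Kgen a : a \in [set x ^+ 2; c ^+ r] -> a \in K.
    move=> Sa; have [i [Ka _]] := genw a Sa; have Wa' := subsetP genW a Sa.
    by rewrite coset_idr ?nKW // Ka coset_id ?groupX.
  by apply: gen_sub_eq; rewrite ?Kgen ?set21 ?set22.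
pose H := (<[u]> <*> L)%G.
have sLH : L \subset H by apply: joing_subr.
have sHW : H \subset W by rewrite join_subG cycle_subG Wu.
have defH : H :=: W.
  apply: (maxnormal_between maxL) => //.
    have nH h : h \in Q -> {in W, forall v, coset L (v ^ h) = coset L v \/
        coset L (v ^ h) = coset L v^-1} -> h \in 'N(H).
      move=> Qh hL; apply/normP/eqP; rewrite eqEcard cardJg leqnn andbT.
      apply/subsetP=> _ /imsetP[v Hv ->]; have Wv := subsetP sHW v Hv.
      have memH z : z \in H -> coset L z = coset L (v ^ h) -> v ^ h \in H.
        move=> Hz /eqP; have Wz := subsetP sHW z Hz.
        rewrite eq_coset ?nLW ?WJ // => /(subsetP sLH) Hzv.
        by rewrite -(mulKVg z (v ^ h)) groupM.
      by case: (hL v Wv) => e; [apply: (memH v) | apply: (memH v^-1); rewrite ?groupV].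
    by apply: norm_rot_sub; apply: nH => //= v Wv; left; apply: Lc.
  apply: contra not_Lu => /subsetP; apply.
  by rewrite (subsetP (joing_subl _ _)) ?cycle_id.
have: w \in H by rewrite defH.
rewrite /= norm_joinEl ?cycle_subG ?nLW // => /mulsgP[_ l /cycleP[j ->] Ll Dw].
have Lw : coset L w = coset L (u ^+ j).
  apply/eqP; rewrite eq_sym eq_coset ?nLW ?groupX //; by rewrite Dw mulKg.
apply: maxnormal_eq maxK maxL _.
(* Modulo [L], [w] is [u ^+ j], so the power [j * 2] takes [u] to [w ^+ 2]. *)
apply: (@sub_of_equivariant _ Q W R K L [set x ^+ 2; c ^+ r] (fun w => w ^+ (j * 2)))
  => //.
- by rewrite -defW.
- by move=> v Wv; rewrite groupX.
- by move=> v v' Wv Wv'; rewrite expgMn //; apply: cW.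
- by move=> v h _ _; rewrite conjXg.
- by move=> v Lv; rewrite groupX.
move=> a Sa; have [i [Ka La]] := genw a Sa; have Wa' := subsetP genW a Sa.
exists (u ^+ i); first exact: groupX.
split; first by rewrite Ka !morphX ?nKW //= Ku.
have -> : (u ^+ i) ^+ (j * 2) = (u ^+ j) ^+ (i * 2) by rewrite -!expgM mulnCA.
rewrite (morphX (coset L) (i * 2) (nLW (groupX j Wu))) /= -Lw.
by rewrite (morphX (coset L) 2 (nLW Wa')) /= La (morphX (coset L) i (nLW Ww)) /= expgM.
Qed.

Lemma submodule_eq : K = L.
Proof.
have trK g := @trivial_mod_transfer K L R g maxK maxL sRW nRQ defRK sRLK.
have trL g := @trivial_mod_transfer L K R g maxL maxK sRW nRQ defRL sRKL.
have [Lc | fLc] := rot_trivial_or_free maxL; last first.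
  (* If [c] were trivial on [W / K], it would be so on [W / L], and freeness there would put [R]
     inside [L]. *)
  have [Kc | fKc] := rot_trivial_or_free maxK.
    by case/negP: not_sRL; apply/subsetP=> u /(subsetP sRW) Wu;
      apply: fLc (trL c Qc Kc u Wu).
  (* Being fixed by [c], the generator [c ^+ r] vanishes in both quotients; only [x ^+ 2] remains to
     be matched. *)
  have bc : (c ^+ r) ^ c = c ^+ r by apply/conjg_fixP/commgP/commute_sym/commuteX.
  have [Kb Lb] : c ^+ r \in K /\ c ^+ r \in L.
    by split; [apply: fKc | apply: fLc]; rewrite ?bc.
  have ax : (x ^+ 2) ^ x = x ^+ 2 by apply/conjg_fixP/commgP/commute_sym/commuteX.
  have [u Ru Ku] := lift_mod Wa; have Wu := subsetP sRW u Ru.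
  have not_Lu : u \notin L.
    by apply: contra not_sWK => /(lift_memL Ru Wa Ku) Ka; apply: gen_sub_eq.
  (* As [x] fixes [x ^+ 2], it fixes [u] modulo [K]; so [u^-1 * u ^ x] is in [R :&: K], hence in
     [L]. *)
  have Lux : coset L (u ^ x) = coset L u.
    apply/esym/eqP; rewrite eq_coset ?nLW ?WJ //; apply: (subsetP sRKL).
    rewrite inE groupM ?groupV //; last by rewrite memJ_norm // (subsetP nRQ).
    rewrite -eq_coset ?nKW ?WJ // morphJ ?(subsetP nKQ x Qx) ?nKW //= Ku.
    by rewrite -{1}ax morphJ ?(subsetP nKQ x Qx) ?nKW.
  (* Modulo [L], [x] sends [u ^ (c ^+ k)] to [u ^ (c ^- k)], so [H] is a submodule. It contains [u],
     hence equals [W], and [x ^+ 2] is modulo [L] a product of conjugates of [u] under powers of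
     [c]. *)
  pose B := <<u ^: <[c]> >>%G; pose H := (B <*> L)%G.
  have sBW : B \subset W.
    rewrite gen_subG; apply/subsetP=> _ /imsetP[g cg ->].
    by rewrite WJ // (subsetP _ g cg) // cycle_subG.
  have sHW : H \subset W by rewrite join_subG sBW.
  have defH : H :=: W.
    apply: (maxnormal_between maxL) => //; first exact: joing_subr.
      apply: norm_rot_sub; last first.
        rewrite -cycle_subG normsY ?norms_gen ?class_norm //.
        by rewrite cycle_subG (subsetP nLQ).
      apply/normP/eqP; rewrite eqEcard cardJg leqnn andbT.
      rewrite /H /= joing_idl -genJ gen_subG.
      apply/subsetP=> _ /imsetP[z /setUP[/imsetP[_ /cycleP[k ->] ->]|Lz] ->]; last first.
        by apply/mem_gen/setUP; right; rewrite memJ_norm ?(subsetP nLQ).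
      have Luu : u^-1 * u ^ x \in L by rewrite -eq_coset ?nLW ?WJ // Lux.
      rewrite conj_rotX // -(mulKVg u (u ^ x)) conjMg groupM //; apply/mem_gen/setUP.
        by left; apply/imsetP; exists (c ^- k); rewrite ?groupV ?mem_cycle.
      by right; rewrite memJ_norm // groupV groupX // (subsetP nLQ).
    apply: contra not_Lu => /subsetP; apply.
    by rewrite (subsetP (joing_subl _ _)) ?mem_gen ?class_refl.
  have: x ^+ 2 \in H by rewrite defH.
  rewrite /= norm_joinEl ?(subset_trans sBW) ?(subset_trans sWQ) //.
  case/mulsgP=> v l Bv Ll Da.
  have [s Dv] := orbit_conj_prod Bv; have Wv := subsetP sBW v Bv.
  have La : coset L (x ^+ 2) = coset L v.
    by apply/eqP; rewrite eq_sym eq_coset ?nLW //; rewrite Da mulKg.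
  apply: maxnormal_eq maxK maxL _.
  (* The equivariant operator [sym_prod s] sends [u] to the square of [x ^+ 2] modulo [L]. *)
  apply: (@sub_of_equivariant _ Q W R K L [set x ^+ 2; c ^+ r] (sym_prod s)) => //.
  - by rewrite -defW.
  - by move=> w; apply: sym_prod_in.
  - exact: sym_prodM.
  - exact: sym_prodJ.
  - by move=> w; apply: sym_prod_in.
  move=> a /set2P[]->; first by exists u => //; split=> //;
    apply: sym_prod_sqr; rewrite // -Dv.
  by exists 1 => //; rewrite (coset_id Kb) (coset_id (groupX 2 Lb)) !coset_id ?sym_prod_in.
have Kc := trK c Qc Lc.
have [Lx | fLx] := refl_trivial_or_free maxL Lc.
  have Kx := trK x Qx Lx.
  (* The images of [x] and [y] modulo [M] centralise that of [W], so [c ^+ r] has square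
     [(x ^+ 2) ^+ r] there. The exponent [#|W|.+1./2] inverts 2 modulo the odd order of [W], which
     makes [c ^+ r] the same power of [x ^+ 2] in both quotients. *)
  have sqb (M : {group gT}) : maxnormal M W Q -> trivial_mod M x -> trivial_mod M c ->
      coset M (c ^+ r) = coset M ((x ^+ 2) ^+ (r * #|W|.+1./2)%N).
    move=> maxM Mx Mc; have /andP[_ nMQ] := maxgroupp maxM.
    have NM g : g \in Q -> g \in 'N(M) by apply: subsetP.
    have cM w g : trivial_mod M g -> g \in Q -> w \in W ->
        commute (coset M w) (coset M g).
      move=> Mg Qg Ww; apply/commgP/conjg_fixP; rewrite -[RHS](Mg w Ww).
      by rewrite morphJ ?NM // (subsetP sWQ).
    have My w : w \in W -> commute (coset M w) (coset M y).
      move=> Ww; rewrite yE morphM ?NM ?groupV //= morphV ?NM //=.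
      by apply: commuteM; [apply: commuteV|]; apply: cM.
    have DXY : coset M c = coset M x * coset M y by rewrite morphM ?NM.
    have Ma : coset M (x ^+ 2) = coset M x ^+ 2 by rewrite morphX ?NM.
    have Mb : coset M (c ^+ r) = (coset M x * coset M y) ^+ r.
      by rewrite morphX ?NM //= DXY.
    have := @expg_prod_involution _ (coset M x) (coset M y) r.
    rewrite -Mb -Ma -morphX ?NM //= y2 morph1 => /(_ erefl (My _ Wa) (My _ Wb)) sq.
    rewrite [RHS]morphX ?NM ?groupX //= expgM -sq -expgM mul2n.
    have -> : (#|W|.+1./2.*2 = #|W|.+1)%N by rewrite -[RHS]odd_double_half /= oddW.
    by rewrite expgSr -morphX ?NM ?groupX //= (expg_cardG Wb) morph1 mul1g.
  apply: (@submodule_eq_cyclic (x ^+ 2)) => //; first by left; apply: Lx.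
  move=> a /set2P[]->; first by exists 1%N; rewrite expg1.
  by exists (r * #|W|.+1./2)%N; rewrite !sqb.
have fKx : free_mod K x.
  have [Kx | //] := refl_trivial_or_free maxK Kc.
  by case/negP: not_sRL; apply/subsetP=> u /(subsetP sRW) Wu;
    apply: fLx (trL x Qx Kx u Wu).
have ax : (x ^+ 2) ^ x = x ^+ 2 by apply/conjg_fixP/commgP/commute_sym/commuteX.
(* Freeness of [x] kills [x ^+ 2], leaving [c ^+ r] as the only generator. *)
have [Ka La] : x ^+ 2 \in K /\ x ^+ 2 \in L.
  by split; [apply: fKx | apply: fLx]; rewrite ?ax.
apply: (@submodule_eq_cyclic (c ^+ r)) => // [v Wv | a /set2P[]->].
- right; have Wvx : v ^ x \in W by apply: WJ.
  (* This product is fixed by [x], so it vanishes modulo [L]: [x] acts as inversion. *)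
  have Lvv : v ^ x * v \in L.
    apply: fLx; first exact: groupM.
    by rewrite [(_ * _) ^ x]conjMg -conjgM -expg2 conj_sqr // (WC Wv).
  apply/esym/eqP; rewrite eq_coset ?nLW ?groupV // invgK WC //.
- by exists 0%N; rewrite expg0 !coset_id.
by exists 1%N; rewrite expg1.
Qed.

End TwoSubmodules.

(** Induction on the list, with [R] the intersection of its tail inside [W]. If [R] lies in [L], the
    tail suffices; otherwise [submodule_eq] identifies the head with [L]. *)
Lemma maxnormal_cap (Ks : seq {group gT}) L :
    {in Ks, forall K : {group gT}, maxnormal K W Q} -> maxnormal L W Q ->
    {in W, forall w, {in Ks, forall K : {group gT}, w \in K} -> w \in L} ->
  L \in Ks.
Proof.
move=> maxKs maxL; have /andP[/andP[_ not_sWL] nLQ] := maxgroupp maxL.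
elim: Ks maxKs => [_ | K Ks IH maxKs] sKsL.
  by case/subsetP: not_sWL => w Ww; apply: sKsL.
have maxK : maxnormal K W Q by apply: maxKs; rewrite mem_head.
have {}maxKs : {in Ks, forall K : {group gT}, maxnormal K W Q}.
  by move=> H KsH; apply: maxKs; rewrite inE KsH orbT.
pose R := foldr (fun H R => (H :&: R)%G) W Ks.
have RP w : reflect (w \in W /\ {in Ks, forall K : {group gT}, w \in K}) (w \in R).
  rewrite /R; elim: (Ks) => [|H s IHs] /=; first by apply: (iffP idP) => [|[]].
  apply: (iffP setIP) => [[Hw /IHs[Ww sw]]|[Ww sw]].
    by split=> // H'; rewrite inE => /predU1P[-> // | /sw].
  split; first by rewrite sw ?mem_head.
  by apply/IHs; split=> // H' sH'; rewrite sw // inE sH' orbT.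
have sRW : R \subset W by apply/subsetP=> w /RP[].
have nRQ : Q \subset 'N(R).
  rewrite /R; elim: (Ks) maxKs => [|H s IHs] //= maxs.
  have /andP[_ nHQ] := maxgroupp (maxs H (mem_head _ _)).
  by rewrite normsI // IHs // => H' sH'; apply: maxs; rewrite inE sH' orbT.
have sRKL : R :&: K \subset L.
  apply/subsetP=> w /setIP[/RP[Ww Ksw] Kw]; apply: sKsL => // H.
  by rewrite inE => /predU1P[-> // | /Ksw].
have [sRL | not_sRL] := boolP (R \subset L); last first.
  by rewrite (submodule_eq maxK maxL sRW nRQ sRKL not_sRL) mem_head.
rewrite inE IH ?orbT // => w Ww Ksw.
by apply: (subsetP sRL); apply/RP.
Qed.

End DihedralModule.

(** * Groups generated by two involutions, and dihedral quotients *)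

Section DihedralKernel.
Local Open Scope group_scope.
Implicit Type gT : finGroupType.

(** As [y] inverts [x * y], the product [<[x * y]> * <[y]>] is a group, and it contains both
    generators. *)
Lemma card_gen_involutions gT (x y : gT) : x ^+ 2 = 1 -> y ^+ 2 = 1 ->
  #|<<[set x; y]>>| <= 2 * #[x * y].
Proof.
move=> x2 y2; set c := x * y.
have xV : x^-1 = x by apply/eqP; rewrite eq_invg_mul -expg2 x2.
have yV : y^-1 = y by apply/eqP; rewrite eq_invg_mul -expg2 y2.
have nc : <[y]> \subset 'N(<[c]>).
  rewrite cycle_subG; apply/normP; rewrite -cycleJ /c conjgE yV -mulgA -expg2 y2 mulg1.
  by rewrite -[RHS]cycleV invMg xV yV.
have sub : <<[set x; y]>> \subset <[c]> * <[y]>.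
  rewrite -norm_joinEr // gen_subG; apply/subsetP=> z /set2P[]->; last first.
    by rewrite (subsetP (joing_subr _ _)) ?cycle_id.
  have -> : x = c * y by rewrite /c -mulgA -expg2 y2 mulg1.
  by rewrite groupM // ?(subsetP (joing_subr _ _) y) ?(subsetP (joing_subl _ _) c) ?cycle_id.
apply: leq_trans (subset_leq_card sub) _.
apply: (@leq_trans (#[c] * #[y])).
  by rewrite /order mul_cardG leq_pmulr ?cardG_gt0.
by rewrite mulnC leq_mul2r orbC dvdn_leq // order_dvdn y2.
Qed.

(** The order of [x * y] divides [2 * r] and is at least [r]. Were it [2 * r], the group would be
    cyclic, hence abelian, and [(x * y) ^+ 2 = 1], against [2 < r]. *)
Lemma expg_gen_involutions gT (x y : gT) r : x ^+ 2 = 1 -> y ^+ 2 = 1 ->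
  2 < r -> #|<<[set x; y]>>| = (2 * r)%N -> (x * y) ^+ r = 1.
Proof.
move=> x2 y2 r_gt2 oG; set c := x * y; set G := <<_>> in oG.
have Gx : x \in G by rewrite mem_gen ?set21.
have Gy : y \in G by rewrite mem_gen ?set22.
have cG : c \in G by rewrite groupM.
have le_r : r <= #[c] by rewrite -(@leq_pmul2l 2) // -oG card_gen_involutions.
have /dvdnP[k Dk] : #[c] %| 2 * r by rewrite -oG order_dvdG.
have k_le2 : k <= 2.
  by rewrite -(@leq_pmul2r #[c]) // -Dk leq_pmul2l.
have : k = 1%N \/ k = 2.
  case: k k_le2 Dk => [|[|[|k]]] // _; [|by left|by right].
  by case: r r_gt2 {le_r oG}.
case=> Ek; last first.
  by apply/eqP; rewrite -order_dvdn; move/eqP: Dk; rewrite Ek eqn_pmul2l // => /eqP <-.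
have defG : G = <[c]>.
  by apply/esym/eqP; rewrite eqEcard cycle_subG cG oG Dk Ek mul1n leqnn.
have c2 : c ^+ 2 = 1.
  rewrite expgMn ?x2 ?y2 ?mulg1 //.
  by apply: (centsP (cycle_abelian c)); rewrite -defG.
have : #[c] %| 2 by rewrite order_dvdn c2.
by move/dvdn_leq => /(_ isT) /(leq_trans le_r); rewrite leqNgt r_gt2.
Qed.

(** The normal closure lies in [A]. Modulo it, [x] and [y] have trivial squares and [x * y] has
    trivial [r]-th power, so its index is at most [2 * r], the index of [A]. *)
Lemma dihedral_kernel gT (Q A : {group gT}) (x y : gT) p r :
    prime p -> ~~ (p %| r) -> 2 < r -> Q :=: <<[set x; y]>> -> A <| Q ->
    #|Q : A| = (2 * r)%N -> y ^+ 2 = 1 -> x ^+ (2 * p) \in A ->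
  A :=: <<class_support [set x ^+ 2; (x * y) ^+ r] Q>>.
Proof.
move=> p_pr p'r r_gt2 defQ nsAQ oQA y2 Ax.
have [sAQ nAQ] := andP nsAQ.
set c := x * y; set S := [set _; _]; pose B := <<class_support S Q>>%G.
have Qx : x \in Q by rewrite defQ mem_gen ?set21.
have Qy : y \in Q by rewrite defQ mem_gen ?set22.
have Qc : c \in Q by rewrite groupM.
have sSQ : S \subset Q by apply/subsetP=> z /set2P[]->; rewrite groupX.
have nsBQ : B <| Q.
  by rewrite /normal norms_gen ?class_support_norm // gen_subG class_support_subG.
have [sBQ nBQ] := andP nsBQ.
have quo (H : {group gT}) : Q \subset 'N(H) -> Q / H = <<[set coset H x; coset H y]>>.
  move=> nHQ; have Nxy z : z \in [set x; y] -> z \in 'N(H).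
    by case/set2P=> ->; apply: (subsetP nHQ).
  rewrite /quotient {1}defQ morphim_gen; last by apply/subsetP.
  rewrite morphimU ?morphim_set1 // ?Nxy ?set21 ?set22 //.
have memA z n : z \in Q -> (coset A z ^+ n == 1) = (z ^+ n \in A).
  move=> Qz; have Nz := subsetP nAQ z Qz.
  rewrite -morphX //=; apply/eqP/idP => [/coset_idr|/coset_id //].
  by apply; rewrite groupX.
have oQA' : #|<<[set coset A x; coset A y]>>| = (2 * r)%N.
  by rewrite -quo // card_quotient.
have Y2 : coset A y ^+ 2 = 1 by apply/eqP; rewrite memA // y2.
(* The order of this coset divides both [2 * p] and [2 * r], whose gcd is 2 since [p] does not
   divide [r]. *)
have X2 : coset A x ^+ 2 = 1.
  apply/eqP; rewrite -order_dvdn; have -> : 2 = gcdn (2 * p) (2 * r).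
    by rewrite -muln_gcdr (eqP (_ : coprime p r)) // prime_coprime.
  rewrite dvdn_gcd order_dvdn memA // Ax /= -oQA' order_dvdG //.
  by rewrite mem_gen ?set21.
have sSA : S \subset A.
  apply/subsetP=> z /set2P[]->; first by rewrite -memA // X2.
  rewrite -memA // morphM ?(subsetP nAQ) //=.
  by rewrite (expg_gen_involutions X2 Y2 r_gt2).
have sBA : B \subset A by rewrite gen_subG class_support_sub_norm.
apply/esym/eqP; rewrite eqEcard sBA /=.
have memB z : z \in S -> coset B z = 1.
  by move=> Sz; rewrite coset_id // mem_gen // (subsetP (sub_class_support _ _)).
have NB z : z \in Q -> z \in 'N(B) by apply: subsetP.
have: #|Q : B| <= #|Q : A|.
  rewrite oQA -card_quotient // quo //.
  apply: leq_trans (card_gen_involutions _ _) _.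
  - by rewrite -morphX ?NB //= memB ?set21.
  - by rewrite -morphX ?NB //= y2 morph1.
  rewrite leq_pmul2l // dvdn_leq //; first by apply: leq_trans r_gt2.
  by rewrite order_dvdn -morphM ?NB //= -morphX ?NB //= memB ?set22.
move=> le_QBA; rewrite -(@leq_pmul2r #|Q : A|) ?indexg_gt0 //.
by rewrite Lagrange // -(Lagrange sBQ) leq_pmul2l.
Qed.

End DihedralKernel.

(** * Monodromy and automorphisms of maps *)

Section MapMorphisms.
Local Open Scope group_scope.

Definition monodromy (E : cmap) : {group {perm dart E}} := <<[set rot E; edg E]>>%G.

Definition map_hom (E N : cmap) (h : dart E -> dart N) :=
  (forall e, h (rot E e) = rot N (h e)) /\ (forall e, h (edg E e) = edg N (h e)).

Definition connected (E : cmap) := [transitive monodromy E, on [set: dart E] | 'P].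

Lemma monodromy_ind (E : cmap) (P : {perm dart E} -> Prop) :
    P 1 -> P (rot E) -> P (edg E) -> (forall q q', P q -> P q' -> P (q * q')) ->
  {in monodromy E, forall q, P q}.
Proof.
move=> P1 Prot Pedg PM q /gen_prodgP[n [e eS ->]].
by elim/big_ind: _ => // i _; case/set2P: (eS i) => ->.
Qed.

Lemma connectedP (E : cmap) : connected E ->
  forall e e', exists2 q, q \in monodromy E & e' = q e.
Proof.
move=> transE e e'.
by have [q Qq ->] := atransP2 transE (in_setT e) (in_setT e'); exists q.
Qed.

Lemma rotaryP (N : cmap) : rotary N -> forall d d', exists2 a, a \in mAut N & d' = a d.
Proof.
move=> rotN d d'.
by have [q Qq ->] := atransP2 rotN (in_setT d) (in_setT d'); exists q.
Qed.

Lemma mAutP (N : cmap) a : a \in mAut N ->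
  (forall d, a (rot N d) = rot N (a d)) /\ (forall d, a (edg N d) = edg N (a d)).
Proof.
move/centP=> ca; split=> d; rewrite -!permM.
  by rewrite (ca (rot N)) ?set21.
by rewrite (ca (edg N)) ?set22.
Qed.

Section OneHom.
Variables (E N : cmap) (h : dart E -> dart N).
Hypotheses (hom_h : map_hom h).

Lemma aut_hom a q e e' : a \in mAut N -> q \in monodromy E ->
  a (h e) = h e' -> a (h (q e)) = h (q e').
Proof.
move=> Na Qq; have [aR aE] := mAutP Na; have [hR hE] := hom_h.
move: q Qq e e'; apply: monodromy_ind => [||| q q' IHq IHq'] e e' aee'.
- by rewrite !perm1.
- by rewrite !hR aR aee'.
- by rewrite !hE aE aee'.
by rewrite !permM; apply/IHq'/IHq.
Qed.

Hypotheses (transE : connected E) (transN : connected N) (rotN : rotary N).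

Lemma hom_surj d : exists e, h e = d.
Proof.
have [q Qq ->] := connectedP transN (h (root E)) d.
have [hR hE] := hom_h.
suff: forall e, exists e', h e' = q (h e) by apply.
move: q Qq; apply: monodromy_ind => [||| q q' IHq IHq'] e.
- by exists e; rewrite perm1.
- by exists (rot E e).
- by exists (edg E e).
have [e1 e1q] := IHq e; have [e2 e2q] := IHq' e1.
by exists e2; rewrite permM -e1q.
Qed.

(** Automorphisms of [N] are transitive and commute with the monodromy action, so an element fixing
    one dart of [N] fixes them all. *)
Lemma hom_fix q e e' : q \in monodromy E -> h (q e) = h e -> h (q e') = h e'.
Proof.
move=> Qq hqe; have [a Na Da] := rotaryP rotN (h e) (h e').
by rewrite -(aut_hom Na Qq (esym Da)) hqe.
Qed.

End OneHom.

Lemma aut_inj (N : cmap) a b d : connected N -> a \in mAut N -> b \in mAut N ->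
  a d = b d -> a = b.
Proof.
move=> transN Na Nb abd; apply/permP=> d'; have [q Qq ->] := connectedP transN d d'.
have fixd : (a * b^-1) d = d by rewrite permM abd permK.
have Nab : a * b^-1 \in mAut N by rewrite groupM ?groupV.
have := @aut_hom N N id _ _ q d d Nab Qq fixd.
by rewrite permM => /(_ (conj (fun=> erefl) (fun=> erefl))) /(canRL (permKV b)).
Qed.

(** * The kernel of a rotary quotient *)

Section Kernel.
Variables (E N : cmap) (h : dart E -> dart N).
Hypotheses (hom_h : map_hom h).
Hypotheses (transE : connected E) (transN : connected N) (rotN : rotary N).

(* The inverse makes the correspondence between the monodromy action and the
   commuting action of the automorphism group a homomorphism. *)
Lemma monodromy_aut_morphism :
  exists pi : {morphism monodromy E >-> {perm dart N}},
    pi @* monodromy E = mAut N /\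
    {in monodromy E, forall q e, (q \in 'ker pi) = (h (q e) == h e)}.
Proof.
pose d0 := h (root E).
(* [autTo d] is the automorphism taking the base dart [d0] to [d], unique by [aut_inj]. *)
have [autTo autP] : exists autTo, forall d, autTo d \in mAut N /\ autTo d d0 = d.
  apply: (@fin_all_exists _ _ (fun d a => a \in mAut N /\ a d0 = d)) => d.
  by have [a Na ->] := rotaryP rotN d0 d; exists a.
pose f (q : {perm dart E}) := (autTo (h (q (root E))))^-1.
have fM : {in monodromy E &, {morph f : q q' / q * q'}}.
  move=> q q' Qq Qq'; rewrite /f -invMg; congr _^-1.
  set a := autTo _; set b := autTo _; set b' := autTo _.
  have [[Na Da] [Nb Db] [Nb' Db']] : [/\ a \in mAut N /\ a d0 = h ((q * q') (root E)),
    b \in mAut N /\ b d0 = h (q' (root E)) & b' \in mAut N /\ b' d0 = h (q (root E))].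
    by split; apply: autP.
  apply: (@aut_inj N _ _ d0) => //; first by rewrite groupM.
  by rewrite Da !permM Db (aut_hom hom_h Nb' Qq' Db').
pose pi := Morphism fM; exists pi; split.
  apply/eqP; rewrite eqEsubset; apply/andP; split; apply/subsetP=> a.
    by case/morphimP=> q _ Qq ->; rewrite /= groupV; case: (autP (h (q (root E)))).
  move=> Na; have [e De] := hom_surj hom_h transN (a^-1 d0).
  have [q Qq Dq] := connectedP transE (root E) e.
  apply/morphimP; exists q => //=; apply: (canRL invgK).
  have [Nb Db] := autP (h (q (root E))).
  by apply: (@aut_inj N _ _ d0) => //; rewrite ?groupV // Db -Dq De.
move=> q Qq e; have [Nb Db] := autP (h (q (root E))).
apply/kerP/eqP => //= [f1|hqe].
  apply: (@hom_fix _ _ _ hom_h rotN q (root E) e Qq).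
  by rewrite -Db -[autTo _]invgK -/(f q) f1 invg1 perm1.
rewrite /f; apply: (canLR invgK); rewrite invg1.
apply: (@aut_inj N _ _ d0) => //; rewrite Db perm1.
exact: (@hom_fix _ _ _ hom_h rotN q e (root E) Qq hqe).
Qed.

Lemma hom_rotX n e : h ((rot E ^+ n) e) = (rot N ^+ n) (h e).
Proof.
have [hR _] := hom_h.
by rewrite !permX; elim: n => //= n <-.
Qed.

(** It depends only on [E] and [r], so all the factors share it. *)
Definition rot_kernel r :=
  <<class_support [set rot E ^+ 2; (rot E * edg E) ^+ r] (monodromy E)>>%G.

(** [K] is the kernel of the morphism onto [mAut N]. The preimage of the abelian part [P] has index
    [2 * r], so [dihedral_kernel] identifies it with [rot_kernel r]; the properties of [P] then pull
    back. *)
Lemma irreducible_kernel p r :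
    prime p -> ~~ (p %| r) -> 2 < r -> edg E ^+ 2 = 1 ->
    (forall d, (rot N ^+ (2 * p)) d = d) -> irreducible_map p r N ->
  exists K : {group {perm dart E}},
    [/\ maxnormal K (rot_kernel r) (monodromy E),
        rot_kernel r <| monodromy E,
        {in rot_kernel r &, forall u v, [~ u, v] \in K},
        {in rot_kernel r, forall w, w ^+ p \in K} &
        {in monodromy E, forall q e, (q \in K) = (h (q e) == h e)}].
Proof.
move=> p_pr p'r r_gt2 y2 rotN2p [P [H [defG abelP isoH irrP]]].
have [pi [imQ kerE]] := monodromy_aut_morphism.
have [nsP _ _ _ _] := sdprod_context defG; have [sPG nPG] := andP nsP.
have oH : #|H| = (2 * r)%N.
  by rewrite (card_isog isoH) mul2n card_dihedral // (ltn_trans _ r_gt2).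
have [abP expP] := abelemP p_pr abelP.
pose A := (pi @*^-1 P)%G; pose Q := monodromy E.
have sPQ : P \subset pi @* Q by rewrite imQ.
have defQ : pi @*^-1 (mAut N) = Q.
  by rewrite -imQ morphimK // mulSGid // subsetIl.
have nsAQ : A <| Q.
  by rewrite -defQ morphpre_normal // imQ.
have oA : #|A| = (#|'ker pi| * #|P|)%N by rewrite card_morphpre.
have oQ : #|Q| = (#|'ker pi| * #|mAut N|)%N.
  by rewrite -[in LHS]defQ card_morphpre // imQ.
have oQA : #|Q : A| = (2 * r)%N.
  apply/eqP; rewrite -(@eqn_pmul2l #|A|) ?cardG_gt0 // (Lagrange (normal_sub nsAQ)).
  by rewrite oQ oA -mulnA -oH (sdprod_card defG).
have kerA : 'ker pi \subset A by rewrite ker_sub_pre.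
have Ax : rot E ^+ (2 * p) \in A.
  apply: (subsetP kerA); rewrite (kerE _ _ (root E)) ?hom_rotX ?rotN2p //.
  by rewrite groupX // mem_gen ?set21.
have defA : A = rot_kernel r.
  by apply/val_inj/(dihedral_kernel p_pr p'r r_gt2 _ nsAQ oQA y2 Ax).
have [/andP[ntP _] minP] := mingroupP irrP.
have AP w : w \in A -> w \in Q /\ pi w \in P.
  by move=> Aw; split; [apply: subsetP (normal_sub nsAQ) w Aw | case/morphpreP: Aw].
have piA : pi @* A = P by rewrite morphpreK.
exists ('ker pi)%G; rewrite -defA; split=> //.
- apply/maxgroupP; split.
    rewrite properE kerA ker_norm andbT /=; apply: contra ntP => sAK.
    by rewrite -piA -subG1 (subset_trans (morphimS pi sAK)) // morphim_ker.
  (* If [B] is strictly above the kernel, its image is a nontrivial submodule of [P], hence [P], and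
     [B] would be all of [A]. *)
  move=> B /andP[prBA nBQ] sKB; apply/eqP; rewrite eqEsubset sKB andbT.
  have [sBA not_sAB] := andP prBA; have sBQ := subset_trans sBA (normal_sub nsAQ).
  apply: contraR not_sAB => not_sBK.
  suff defB : pi @* B = P.
    by rewrite /A /= -defB morphimK // mulSGid.
  apply: (minP [group of pi @* B]); last by rewrite /= -piA morphimS.
  rewrite /= astabsJ -subG1 sub_morphim_pre // not_sBK /=.
  have sHG : H \subset mAut N by case/sdprod_context: defG.
  by rewrite (subset_trans sHG) // -imQ morphim_norms.
- move=> u v /AP[Qu Pu] /AP[Qv Pv]; apply/kerP; rewrite ?groupR // morphR //.
  by apply/eqP/commgP; apply: (centsP abP).
- by move=> w /AP[Qw Pw]; apply/kerP; rewrite ?groupX // morphX // expP.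
Qed.

End Kernel.

(** Any two darts of [E] differ by a monodromy element, so [h1] and [h2] have the same fibres. The
    isomorphism is [h2] after a section of [h1]. *)
Lemma map_iso_of_kernel (E N1 N2 : cmap) (h1 : dart E -> dart N1)
    (h2 : dart E -> dart N2) (K : {set {perm dart E}}) :
    map_hom h1 -> map_hom h2 -> connected E -> connected N1 -> connected N2 ->
    {in monodromy E, forall q e, (q \in K) = (h1 (q e) == h1 e)} ->
    {in monodromy E, forall q e, (q \in K) = (h2 (q e) == h2 e)} ->
  map_iso N1 N2.
Proof.
move=> hom1 hom2 transE trans1 trans2 K1 K2.
have eq12 e e' : (h1 e == h1 e') = (h2 e == h2 e').
  by have [q Qq ->] := connectedP transE e' e; rewrite -K1 // -K2.
have [s1 s1P] := fin_all_exists (hom_surj hom1 trans1).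
have [s2 s2P] := fin_all_exists (hom_surj hom2 trans2).
have fE e : h2 (s1 (h1 e)) = h2 e by apply/eqP; rewrite -eq12 s1P.
have gE e : h1 (s2 (h2 e)) = h1 e by apply/eqP; rewrite eq12 s2P.
have [[R1 E1] [R2 E2]] := (hom1, hom2).
exists (h2 \o s1); split=> [|d|d] /=.
- exists (h1 \o s2) => d /=; first by rewrite gE s1P.
  by rewrite fE s2P.
- by rewrite -{1}(s1P d) -R1 fE R2.
by rewrite -{1}(s1P d) -E1 fE E2.
Qed.

Lemma map_iso_sym (M N : cmap) : map_iso M N -> map_iso N M.
Proof.
case=> f [[g fK gK] fR fE]; exists g; split=> [|d|d]; first by exists f.
  by rewrite -{1}(gK d) -fR fK.
by rewrite -{1}(gK d) -fE fK.
Qed.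

Lemma map_iso_trans (M N L : cmap) : map_iso M N -> map_iso N L -> map_iso M L.
Proof.
case=> f [bij_f fR fE] [g [bij_g gR gE]]; exists (g \o f).
by split=> [|d|d] /=; [apply: bij_comp | rewrite fR gR | rewrite fE gE].
Qed.

Lemma is_map_connected (M : cmap) : is_map M -> connected M.
Proof. by case. Qed.


(** * Projections and connectedness of the product *)

Section ProductMap.
Variables (m : nat) (M : 'I_m -> cmap).

Definition prod_proj i (x : dart (prod_map M)) : dart (M i) := val x i.

Lemma prod_proj_hom i : map_hom (@prod_proj i).
Proof. by split=> x; rewrite /prod_proj permE /= ffunE. Qed.

Lemma prod_proj_inj x y : (forall i, prod_proj i x = prod_proj i y) -> x = y.
Proof. by move=> xy; apply/val_inj/ffunP. Qed.

(** The darts are the points reached from the root by forward steps; the induction is on the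
    path. *)
Lemma prod_map_ind (P : dart (prod_map M) -> Prop) :
    P (root (prod_map M)) ->
    (forall x, P x -> P (rot (prod_map M) x)) ->
    (forall x, P x -> P (edg (prod_map M) x)) ->
  forall x, P x.
Proof.
move=> P0 PR PE [x Cx]; have := Cx; rewrite inE => /connectP[s].
elim/last_ind: s x Cx => [|s y IHs] x Cx /=.
  move=> _ Dx; rewrite (_ : exist _ _ _ = root (prod_map M)) //.
  exact: val_inj.
rewrite rcons_path last_rcons => /andP[path_s stepy] Dx.
have Cy : last (proot M) s \in pcomp M by rewrite inE; apply/connectP; exists s.
have Py := IHs _ Cy path_s erefl.
case/orP: stepy => /eqP Dy.
  have := PR _ Py; congr P; apply: val_inj; rewrite permE /= Dx Dy //.
have := PE _ Py; congr P; apply: val_inj; rewrite permE /= Dx Dy //.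
Qed.

Lemma prod_map_connected : connected (prod_map M).
Proof.
apply/imsetP; exists (root (prod_map M)) => //; apply/esym/eqP; rewrite -subTset.
apply/subsetP=> x _; move: x; apply: prod_map_ind => [|x|x].
- exact: orbit_refl.
- case/imsetP=> q Qq ->; apply/imsetP; exists (q * rot (prod_map M)).
    by rewrite groupM // mem_gen ?set21.
  by rewrite /= /aperm permM.
case/imsetP=> q Qq ->; apply/imsetP; exists (q * edg (prod_map M)).
  by rewrite groupM // mem_gen ?set22.
by rewrite /= /aperm permM.
Qed.

End ProductMap.
End MapMorphisms.

(** * Valencies of augmented PX graphs *)

Section Valency.
Local Open Scope group_scope.

Lemma ord_pred_neq r (i : 'I_r) : 1 < r -> (i == ord_pred i) = false.
Proof.
move=> r_gt1; apply/negP=> /eqP Di.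
have /(congr1 val) /= : ordS i = i by rewrite {1}Di ord_predK.
have := ltn_ord i; rewrite leq_eqVlt => /predU1P[Ei | lt_i].
  by rewrite Ei modnn => i0; rewrite -Ei -i0 in r_gt1.
by rewrite modn_small // => /esym/n_Sn.
Qed.

Lemma px_valency r p s v : 1 < r -> #|[set e | @px_inc r p s e v]| = (2 * p)%N.
Proof.
move=> r_gt1; case: v => i f.
(* [ext k0 a] inserts [a] at position [k0]. The edges at [(i, f)] append a last coordinate to [f] in
   layer [i], or prepend a first one in the preceding layer; [G] lists both kinds. *)
pose ext (k0 : 'I_s.+1) (a : 'I_p) : {ffun 'I_s.+1 -> 'I_p} :=
  [ffun k => if unlift k0 k is Some k' then f k' else a].
have ext_lift k0 a k : ext k0 a (lift k0 k) = f k by rewrite ffunE liftK.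
have ext_none k0 a : ext k0 a k0 = a by rewrite ffunE unlift_none.
pose G (b : bool * 'I_p) :=
  if b.1 then (i, ext ord_max b.2) else (ord_pred i, ext ord0 b.2).
have widenE k : widen_ord (leqnSn s) k = lift ord_max k.
  by apply: val_inj; rewrite [RHS]lift_max.
have extP (k0 : 'I_s.+1) (g : {ffun 'I_s.+1 -> 'I_p}) :
    (forall k : 'I_s, f k = g (lift k0 k)) -> g = ext k0 (g k0).
  by move=> fg; apply/ffunP=> k; rewrite ffunE; case: unliftP => [j ->|->].
have G_inj : injective G.
  case=> [[] a] [[] b]; rewrite /G /= => - [].
  - by move=> /(congr1 (fun g : {ffun _} => g ord_max)); rewrite !ext_none => ->.
  - by move/eqP; rewrite ord_pred_neq.
  - by move/eqP; rewrite eq_sym ord_pred_neq.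
  by move=> /(congr1 (fun g : {ffun _} => g ord0)); rewrite !ext_none => ->.
rewrite (_ : [set e | _] = G @: setT).
  by rewrite card_imset // cardsT card_prod card_bool card_ord.
apply/setP=> -[j g]; rewrite inE /px_inc /=; apply/idP/imsetP => [|[[[] a] _ [-> ->]]].
- case/orP=> /andP[/eqP ij /forallP fg].
    exists (true, g ord_max) => //; rewrite /G /= ij -extP // => k.
    by rewrite (eqP (fg k)) widenE.
  exists (false, g ord0) => //; rewrite /G /= ij ordSK -extP // => k.
  by rewrite (eqP (fg k)).
- by rewrite eqxx /=; apply/orP; left; apply/forallP=> k; rewrite widenE ext_lift.
by rewrite ord_predK eqxx /=; apply/orP; right; apply/forallP=> k; rewrite ext_lift.
Qed.

Lemma pcyc_valency r p v : 1 < r -> #|[set e | @pcyc_inc r p e v]| = (2 * p)%N.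
Proof.
move=> r_gt1; pose G (b : bool * 'I_p) := (if b.1 then v else ord_pred v, b.2).
have G_inj : injective G.
  case=> [[] a] [[] b]; rewrite /G /= => -[].
  - by move=> ->.
  - by move/eqP; rewrite ord_pred_neq.
  - by move/eqP; rewrite eq_sym ord_pred_neq.
  by move=> ->.
rewrite (_ : [set e | _] = G @: setT).
  by rewrite card_imset // cardsT card_prod card_bool card_ord.
apply/setP=> -[j g]; rewrite inE /pcyc_inc /=; apply/idP/imsetP => [|[[[] a] _ [-> _]]].
- case/orP=> /eqP vj; first by exists (true, g); rewrite /G //= vj.
  by exists (false, g); rewrite /G //= vj ordSK.
- by rewrite eqxx.
by rewrite ord_predK eqxx orbT.
Qed.

(** Divisibility also covers [n = 1], where the two edges coincide. *)
Lemma cyc_valency n v : #|[set e | @cyc_inc n e v]| %| 2.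
Proof.
rewrite (_ : [set e | _] = [set v; ord_pred v]); first by rewrite cards2; case: eqP.
apply/setP=> e; rewrite !inE /cyc_inc eq_sym; congr (_ || _).
by apply/eqP/eqP => [->|->]; rewrite ?ordSK ?ord_predK.
Qed.

Lemma edg_orbit (M : cmap) d d' : is_map M -> d' \in orbit 'P <[edg M]> d ->
  d' = d \/ d' = edg M d.
Proof.
case=> edgK _ _ _ /imsetP[_ /cycleP[k ->] ->]; rewrite /= /aperm permX.
elim: k => [|k [] /= ->]; [by left | by right | by left].
Qed.

(** Without loops, distinct darts at a vertex lie on distinct edges. *)
Lemma valency_rot (M : cmap) d (v : mvtype M) : is_map M ->
  val v = orbit 'P <[rot M]> d -> #|[set e : metype M | minc e v]| = #|porbit (rot M) d|.
Proof.
move=> mapM Dv; have [_ _ _ noloop] := mapM.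
have edgeP d' : orbit 'P <[edg M]> d' \in medges M by apply: imset_f.
pose E d' : metype M := exist (fun A => A \in medges M) _ (edgeP d').
have E_inj : {in val v &, injective E}.
  move=> d1 d2 vd1 vd2 [Ed]; have : d2 \in orbit 'P <[edg M]> d1 by rewrite Ed orbit_refl.
  case/(edg_orbit mapM) => // Dd2; case/negP: (noloop d1).
  move: vd1 vd2; rewrite Dv => /orbit_eqP vd1 vd2.
  by rewrite -Dd2 vd1.
have -> : porbit (rot M) d = val v by rewrite Dv porbit.unlock.
rewrite -(card_in_imset E_inj); apply: eq_card => e; rewrite inE.
apply/set0Pn/imsetP => [[d1 /setIP[ed1 vd1]]|[d1 vd1 ->]]; last first.
  by exists d1; rewrite inE vd1 /= orbit_refl.
exists d1 => //; apply: val_inj => /=; have /imsetP[d0 _ De] := valP e.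
by move: ed1; rewrite De => /orbit_eqP ->.
Qed.

Lemma valency_iso (V1 E1 V2 E2 : finType) (inc1 : E1 -> V1 -> bool)
    (inc2 : E2 -> V2 -> bool) v : mgraph_iso inc1 inc2 ->
  exists v2, #|[set e | inc1 e v]| = #|[set e | inc2 e v2]|.
Proof.
case=> fV [fE [_ bijE incE]]; exists (fV v).
rewrite -(card_imset _ (bij_inj bijE)); apply: eq_card => e2; rewrite inE.
have [gE gK fK] := bijE; apply/imsetP/idP => [[e + ->]|]; first by rewrite inE incE.
by exists (gE e2); rewrite ?fK // inE -incE fK.
Qed.

(** Each cycle of [rot M] has the length of a valency, which is [2 * p] or a divisor of 2. *)
Lemma rot_expg p r (M : cmap) : 1 < r -> is_map M -> augPX_map p r M ->
  forall d, (rot M ^+ (2 * p)) d = d.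
Proof.
move=> r_gt1 mapM pxM d.
have vP : orbit 'P <[rot M]> d \in mverts M by apply: imset_f.
pose v : mvtype M := exist (fun A => A \in mverts M) _ vP.
have degv := valency_rot mapM (erefl : val v = _).
suff /dvdnP[k ->] : #|porbit (rot M) d| %| 2 * p.
  rewrite mulnC expgM permX; elim: k => //= k ->.
  by rewrite permX iter_porbit.
rewrite -degv; case: pxM => [[s [_ iso]] | [iso|iso]].
- by have [v2 ->] := valency_iso v iso; rewrite px_valency.
- by have [v2 ->] := valency_iso v iso; rewrite pcyc_valency.
by have [v2 ->] := valency_iso v iso; apply: dvdn_mulr; apply: cyc_valency.
Qed.

End Valency.

(** * Factors of a product map *)

Section Factors.
Local Open Scope group_scope.

(** Products are formed from the roots, so isomorphisms of factors must respect them; an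
    automorphism of the rotary target corrects the image of the root. *)
Lemma rooted_map_iso (M N : cmap) : rotary N -> map_iso M N ->
  exists f : dart M -> dart N, [/\ bijective f, map_hom f & f (root M) = root N].
Proof.
move=> rotN [f [bij_f fR fE]]; have [a Na Da] := rotaryP rotN (f (root M)) (root N).
have [aR aE] := mAutP Na; exists (a \o f); split=> //.
  by apply: bij_comp bij_f; exists a^-1 => d; rewrite ?permK ?permKV.
by split=> d /=; rewrite ?fR ?fE ?aR ?aE.
Qed.

Lemma prod_map_iso m n (M : 'I_m -> cmap) (N : 'I_n -> cmap) (t : 'I_n -> 'I_m) :
    bijective t -> (forall j, rotary (N j)) -> (forall j, map_iso (M (t j)) (N j)) ->
  map_iso (prod_map M) (prod_map N).
Proof.
case=> t' tK t'K rotN isoMN.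
have [g gP] := fin_all_exists (fun j => rooted_map_iso (rotN j) (isoMN j)).
pose F (x : pdart M) : pdart N := [ffun j => g j (x (t j))].
have F_rot x : F (prot_fun x) = prot_fun (F x).
  by apply/ffunP=> j; rewrite !ffunE; have [_ [-> _] _] := gP j.
have F_edg x : F (pedg_fun x) = pedg_fun (F x).
  by apply/ffunP=> j; rewrite !ffunE; have [_ [_ ->] _] := gP j.
have F_root : F (proot M) = proot N.
  by apply/ffunP=> j; rewrite !ffunE; have [_ _ ->] := gP j.
have FC (x : dart (prod_map M)) : F (val x) \in pcomp N.
  move: x; apply: prod_map_ind => [|x Cx|x Cx] /=; first by rewrite F_root proot_in.
    by rewrite permE /= F_rot pcomp_rot.
  by rewrite permE /= F_edg pcomp_edg.
pose f x : dart (prod_map N) := exist (fun y => y \in pcomp N) _ (FC x).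
have f_rot x : f (rot _ x) = rot _ (f x).
  by apply: val_inj; rewrite permE /= permE /= F_rot.
have f_edg x : f (edg _ x) = edg _ (f x).
  by apply: val_inj; rewrite permE /= permE /= F_edg.
have f_inj : injective f.
  move=> x y [/ffunP Fxy]; apply: val_inj; apply/ffunP=> i.
  rewrite -(t'K i); have := Fxy (t' i); rewrite !ffunE.
  by have [/bij_inj gi _ _] := gP (t' i); move/gi.
have [s sP] : exists s, forall y, f (s y) = y.
  apply: (@fin_all_exists _ _ (fun y x => f x = y)).
  apply: prod_map_ind => [|y [x <-]|y [x <-]].
  - by exists (root (prod_map M)); apply: val_inj; rewrite /= F_root.
  - by exists (rot (prod_map M) x).
  by exists (edg (prod_map M) x).
by exists f; split=> //; exists s => // x; apply: f_inj.
Qed.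

(** Through [f], the map [N j] is a quotient of the product of the [M i]. Its kernel [L] and the
    kernels [K i] of the projections are maximal in the same [W], and the [K i] meet trivially, so
    [L] is one of them. *)
Lemma prod_map_factor p r m n (M : 'I_m -> cmap) (N : 'I_n -> cmap) :
    prime p -> odd p -> 2 < r -> ~~ (p %| r) ->
    (forall i, [/\ is_map (M i), rotary (M i), augPX_map p r (M i)
                 & irreducible_map p r (M i)]) ->
    (forall j, [/\ is_map (N j), rotary (N j), augPX_map p r (N j)
                 & irreducible_map p r (N j)]) ->
    map_iso (prod_map M) (prod_map N) ->
  forall j, exists i, map_iso (M i) (N j).
Proof.
move=> p_pr odd_p r_gt2 p'r MP NP [f [_ fR fE]] j; set E := prod_map M in f fR fE.
have transE : connected E := prod_map_connected M.
have y2 : edg E ^+ 2 = 1.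
  apply/permP=> x; rewrite perm1 permX /=; apply: prod_proj_inj => i.
  have [_ homE] := prod_proj_hom M i; rewrite !homE.
  by have [[-> _ _ _] _ _ _] := MP i.
have kernel (N' : cmap) (h : dart E -> dart N') : map_hom h ->
    [/\ is_map N', rotary N', augPX_map p r N' & irreducible_map p r N'] ->
  exists K : {group {perm dart E}},
    [/\ maxnormal K (rot_kernel E r) (monodromy E),
        rot_kernel E r <| monodromy E,
        {in rot_kernel E r &, forall u v, [~ u, v] \in K},
        {in rot_kernel E r, forall w, w ^+ p \in K} &
        {in monodromy E, forall q e, (q \in K) = (h (q e) == h e)}].
  move=> hom_h [mapN rotN pxN irrN]; apply: irreducible_kernel => //.
    exact: is_map_connected.
  exact: rot_expg (ltnW r_gt2) mapN pxN.
have [K KP] := fin_all_exists (fun i => kernel _ _ (prod_proj_hom M i) (MP i)).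
pose h x := prod_proj j (f x).
have hom_h : map_hom h.
  by have [hR hE] := prod_proj_hom N j; split=> x; rewrite /h ?fR ?fE ?hR ?hE.
have [L [maxL nsW _ _ kerL]] := kernel _ _ hom_h (NP j).
pose W := rot_kernel E r.
have sWQ := normal_sub nsW.
have trivK q : q \in monodromy E -> (forall i, q \in K i) -> q = 1.
  move=> Qq Kq; apply/permP=> x; rewrite perm1; apply: prod_proj_inj => i.
  by apply/eqP; have [_ _ _ _ kerK] := KP i; rewrite -(kerK q Qq).
(* Commutators and [p]-th powers of elements of [W] lie in every [K i], hence are trivial. *)
have abelW : p.-abelem W.
  apply/abelemP => //; split.
    apply/centsP=> u Wu v Wv; apply/commgP/eqP; apply: trivK => [|i].
      by rewrite groupR ?(subsetP sWQ).
    by have [_ _ KR _ _] := KP i; apply: KR.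
  move=> w Ww; apply: trivK => [|i]; first by rewrite groupX ?(subsetP sWQ).
  by have [_ _ _ KX _] := KP i; apply: KX.
have oddW : odd #|W|.
  by rewrite (card_pgroup (abelem_pgroup abelW)) oddX odd_p orbT.
have KL : L \in [seq K i | i <- enum 'I_m].
  apply: (@maxnormal_cap _ _ _ (rot E) (edg E) r _ y2 nsW (abelem_abelian abelW)
    oddW _ _ L) => // [_ /mapP[i _ ->]|w Ww Kw]; first by case: (KP i).
  rewrite (trivK w) ?(subsetP sWQ) // => i; apply: Kw.
  by apply/mapP; exists i; rewrite ?mem_enum.
have [i _ DL] := mapP KL; exists i; have [_ _ _ _ kerK] := KP i.
apply: (map_iso_of_kernel (prod_proj_hom M i) hom_h transE _ _ kerK).
- by have [/is_map_connected] := MP i.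
- by have [/is_map_connected] := NP j.
by rewrite -DL.
Qed.

End Factors.

(** * Matching the factors of two products *)

Theorem theorem6p8 (p r : nat) (m n : nat)
    (M : 'I_m -> cmap) (N : 'I_n -> cmap) :
  prime p -> odd p -> 3 <= r -> ~~ (p %| r) ->
  (forall i, [/\ is_map (M i), rotary (M i), augPX_map p r (M i)
               & irreducible_map p r (M i)]) ->
  (forall j, [/\ is_map (N j), rotary (N j), augPX_map p r (N j)
               & irreducible_map p r (N j)]) ->
  (forall i i' : 'I_m, i != i' -> ~ map_iso (M i) (M i')) ->
  (forall j j' : 'I_n, j != j' -> ~ map_iso (N j) (N j')) ->
  (map_iso (prod_map M) (prod_map N) <->
   m = n /\ exists sigma : 'I_m -> 'I_n,
              bijective sigma /\ forall i, map_iso (M i) (N (sigma i))).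
Proof.
move=> p_pr odd_p r_gt2 p'r MP NP Mdistinct Ndistinct; split; last first.
  case=> _ [s [[t sK tK] isoMN]]; apply: (@prod_map_iso _ _ _ _ t).
  - by exists s.
  - by move=> j; have [] := NP j.
  by move=> j; have := isoMN (t j); rewrite tK.
move=> isoMN.
have [t tP] := fin_all_exists (prod_map_factor p_pr odd_p r_gt2 p'r MP NP isoMN).
have [s sP] := fin_all_exists
  (prod_map_factor p_pr odd_p r_gt2 p'r NP MP (map_iso_sym isoMN)).
(* [M (t (s i))] and [M i] are both isomorphic to [N (s i)], so distinctness forces [t (s i) = i];
   the other composite is symmetric. *)
have bij_s : bijective s.
  exists t => [i | j]; apply/eqP; apply: contraT => neq.
    by case: (Mdistinct _ _ neq); apply: map_iso_trans (tP (s i)) (sP i).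
  by case: (Ndistinct _ _ neq); apply: map_iso_trans (sP (t j)) (tP j).
split; first by rewrite -(card_ord m) -(card_ord n); apply: bij_eq_card bij_s.
by exists s; split=> // i; apply: map_iso_sym.
Qed.
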